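(* Let $m\geq 2$ and let $G_t$ be a connected graph with $m$ edges and $t$ edge-disjoint triangles. Then $\mathrm{scfc}(G_t)\leq m-2t$, and equality holds if and only if $G_t$ is isomorphic to $S_{m,t}$.
   Context: All graphs are finite, simple and undirected. Edge-colorings are arbitrary (adjacent edges may receive the same color). A path in an edge-colored graph is conflict-free if some color is used on exactly one of its edges. An edge-colored graph $G$ is strongly conflict-free connected if for every pair of distinct vertices $u,v$ there is a conflict-free path of length $d_G(u,v)$ connecting them. For a connected graph $G$, $\mathrm{scfc}(G)$ is the smallest number of colors in an edge-coloring making $G$ strongly conflict-free connected. The graph $S_{m,t}$ is the graph with $m$ edges obtained from a star with $m-t$ leaves by adding $t$ pairwise vertex-disjoint edges joining pairs of leaves; it thus consists of $t$ triangles and $m-3t$ pendant edges all sharing the center vertex of the star (this requires $m\geq 3t$). *)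

(* Defs.v *)
From mathcomp Require Import all_boot.

Set Implicit Arguments.
Unset Strict Implicit.
Unset Printing Implicit Defensive.

Record sgraph := SGraph {
  vertex :> finType;
  adj : rel vertex;
  adj_sym : symmetric adj;
  adj_irrefl : irreflexive adj }.

Definition edge_set (G : sgraph) : {set {set G}} :=
  [set [set p.1; p.2] | p : G * G & adj p.1 p.2].

Definition edge (G : sgraph) : finType := {e : {set G} | e \in edge_set G}.

Definition connected (G : sgraph) : bool :=
  (0 < #|G|) && [forall x : G, forall y : G, connect (@adj G) x y].

Definition sg_iso (G H : sgraph) : Prop :=
  exists2 f : G -> H, bijective f & forall x y : G, adj (f x) (f y) = adj x y.

(* As in path.v, the path x = x_0, x_1, ..., x_n is given by its origin x and
   the sequence p = [:: x_1; ...; x_n], so that its length is size p. *)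
Definition path_from_to (G : sgraph) (x y : G) (p : seq G) : bool :=
  [&& path (@adj G) x p, last x p == y & uniq (x :: p)].

Definition path_edges (G : sgraph) (x : G) (p : seq G) : seq {set G} :=
  pairmap (fun u v => [set u; v]) x p.

(* A path has fewer than #|G| edges, so the search is exhaustive; the value is
   #|G| when x and y lie in different components. *)
Definition dist (G : sgraph) (x y : G) : nat :=
  find (fun n => [exists p : n.-tuple G, path_from_to x y p]) (iota 0 #|G|).

Definition conflict_free (G : sgraph) (k : nat) (c : {ffun edge G -> 'I_k})
    (x : G) (p : seq G) : bool :=
  [exists a : 'I_k,
    #|[set e : edge G | (val e \in path_edges x p) && (c e == a)]| == 1].

Definition strongly_cf_connected (G : sgraph) (k : nat)
    (c : {ffun edge G -> 'I_k}) : bool :=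
  [forall x : G, forall y : G, (x != y) ==>
    [exists p : (dist x y).-tuple G, path_from_to x y p && conflict_free c x p]].

Definition scf_colorable (G : sgraph) (k : nat) : bool :=
  [exists c : {ffun edge G -> 'I_k}, strongly_cf_connected c].

Lemma dist_path (G : sgraph) (x y : G) : connected G ->
  exists p : (dist x y).-tuple G, path_from_to x y p.
Proof.
case/andP=> _ /forallP/(_ x)/forallP/(_ y)/connectP[q eq_q ->].
case: (shortenP eq_q) => p pP pU _.
set P := fun n => [exists p0 : n.-tuple G, path_from_to x (last x p) p0].
have ltp : size p < #|G|.
  by have := max_card (mem (x :: p)); rewrite (card_uniqP pU).
have hasP' : has P (iota 0 #|G|).
  apply/hasP; exists (size p); first by rewrite mem_iota.
  by apply/existsP; exists (in_tuple p); rewrite /path_from_to pP eqxx pU.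
have := nth_find 0 hasP'; rewrite -/(dist x (last x p)).
rewrite nth_iota; last by rewrite -[X in _ < X](size_iota 0) -has_find.
by rewrite add0n => /existsP.
Qed.

Lemma scf_colorable_exists (G : sgraph) : connected G ->
  exists k, scf_colorable G k.
Proof.
move=> Gc; exists #|edge G|; apply/existsP; exists [ffun e => enum_rank e].
apply/forallP=> x; apply/forallP=> y; apply/implyP=> neq_xy.
have [p pP] := dist_path x y Gc; apply/existsP; exists p; rewrite pP /=.
case: (tval p) pP => [|z q].
  by case/and3P=> _ /= /eqP exy; rewrite exy eqxx in neq_xy.
case/and3P=> /= /andP[xz _] _ _.
have eP : [set x; z] \in edge_set G by apply/imsetP; exists (x, z); rewrite ?inE.
pose e : edge G := Sub [set x; z] eP.
apply/existsP; exists (enum_rank e); apply/cards1P; exists e.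
apply/setP=> f; rewrite !inE ffunE (inj_eq enum_rank_inj).
case: (eqVneq f e) => [->|_]; last by rewrite andbF.
by rewrite /= eqxx.
Qed.

Definition scfc (G : sgraph) (Gconn : connected G) : nat :=
  ex_minn (scf_colorable_exists Gconn).

Definition triangle (G : sgraph) (T : {set G}) : bool :=
  (#|T| == 3) && [forall x in T, forall y in T, (x != y) ==> adj x y].

Definition edges_within (G : sgraph) (T : {set G}) : {set {set G}} :=
  [set e in edge_set G | e \subset T].

Definition has_edge_disjoint_triangles (G : sgraph) (t : nat) : Prop :=
  exists F : {set {set G}},
    [/\ #|F| = t,
        forall T, T \in F -> triangle T &
        forall T1 T2, T1 \in F -> T2 \in F -> T1 != T2 ->
          [disjoint edges_within T1 & edges_within T2]].

(* S_{m,t}, meaningful for 3 * t <= m: None is the center, the m - t leaves are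
   the Some i, and the leaves 2 * j and 2 * j + 1 are joined for each j < t. *)
Definition star_tri_adj (m t : nat) : rel (option 'I_(m - t)) :=
  fun x y => match x, y with
  | None, None => false
  | None, Some _ | Some _, None => true
  | Some i, Some j => [&& i != j, i./2 == j./2 & i./2 < t]
  end.

Lemma star_tri_adj_sym (m t : nat) : symmetric (@star_tri_adj m t).
Proof.
case=> [i|] [j|] //=; rewrite (eq_sym i j) (eq_sym i./2 j./2).
by case: (j./2 =P i./2) => [->|_].
Qed.

Lemma star_tri_adj_irrefl (m t : nat) : irreflexive (@star_tri_adj m t).
Proof. by case=> [i|] //=; rewrite eqxx. Qed.

Definition star_tri (m t : nat) : sgraph :=
  SGraph (@star_tri_adj_sym m t) (@star_tri_adj_irrefl m t).

(* Main.v *)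
Require Import Defs.
From mathcomp Require Import all_boot zify.

Set Implicit Arguments.
Unset Strict Implicit.
Unset Printing Implicit Defensive.

(** The [t] triangles, together with the edges outside them as blocks of size
    two, partition the edges into [m - 2 * t] cliques, two of which share at most
    one vertex ([triangle_partitionP], [card_triangle_partition]).

    A geodesic has at most one edge in a clique. Hence, if every edge is coloured
    by its block, the edges of a geodesic have distinct colours; this proves the
    upper bound ([scfc_le_clique_partition]).

    A colour can be saved unless all blocks have a common vertex
    ([scfc_lt_no_common_vertex]). If two blocks are disjoint, they may share a
    colour: a geodesic could lose the uniqueness of all its colours only if it
    consisted of two consecutive edges, one in each block. Otherwise all blocks
    meet, so the diameter is at most two, and if they have no common vertex, then
    three of them meet in three different vertices. Those three blocks are
    coloured with two colours by a cyclically symmetric rule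
    ([two_colored_corner]), under which non-adjacent vertices of the three blocks
    are still joined by a path of length two with two colours.

    If all blocks do have a common vertex, they are triangles and edges that share
    only this vertex, that is, the graph is the star with [t] triangles
    ([star_tri_iso]). Conversely, in that star choose one leaf in each triangle
    and all pendant vertices. Two of these leaves are joined by a single geodesic,
    which passes through the centre, so the spokes to the [m - 2 * t] leaves need
    distinct colours ([scfc_ge_star_tri]). *)

(** * Geodesics *)

Lemma dist_le_walk (G : sgraph) (x y : G) (p : seq G) :
  path (@adj G) x p -> last x p = y -> dist x y <= size p.
Proof.
move=> + yE; rewrite -{}yE => /shortenP[q qP qU qp].
have leqp : size q <= size p.
  by apply: uniq_leq_size qp; case/andP: qU.
apply: leq_trans leqp; rewrite leqNgt; apply/negP => ltqd.
have ltqG : size q < #|G|.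
  by have := max_card (mem (x :: q)); rewrite (card_uniqP qU).
have := before_find 0 ltqd; rewrite nth_iota // => /existsP[].
by exists (in_tuple q); rewrite /path_from_to qP eqxx qU.
Qed.

Lemma geodesic_exists (G : sgraph) (x y : G) : connected G ->
  exists2 p, path_from_to x y p & size p = dist x y.
Proof.
by case/(@dist_path _ x y) => p pP; exists p; rewrite ?size_tuple.
Qed.

Lemma dist_common_neighbour (G : sgraph) (x y z : G) : connected G ->
  x != y -> ~~ adj x y -> adj x z -> adj z y -> dist x y = 2.
Proof.
move=> Gc xNy xyN xz zy; apply/eqP; rewrite eqn_leq.
rewrite (@dist_le_walk _ _ _ [:: z; y]) /= ?xz ?zy //.
have [p + <-] := geodesic_exists x y Gc; case: p => [|a [|b p]] //.
  by case/and3P=> _ /=; rewrite (negPf xNy).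
by case/and3P=> /= /andP[xa _] /eqP ay; rewrite -ay xa in xyN.
Qed.

Lemma path_edges_adj (G : sgraph) (x : G) (p : seq G) (e : {set G}) :
  path (@adj G) x p -> e \in path_edges x p ->
  exists2 uv, adj uv.1 uv.2 & e = [set uv.1; uv.2].
Proof.
elim: p x => [|z p IHp] x //= /andP[xz zp]; rewrite inE => /predU1P[->|].
  by exists (x, z).
exact: IHp.
Qed.

Definition clique (G : sgraph) (B : {set G}) : Prop :=
  {in B &, forall u v, u != v -> adj u v}.

(** Two edges of a clique on one geodesic could be bypassed: the first vertex of
    the earlier one is adjacent to the last vertex of the later one, and going
    straight from one to the other shortens the path. *)
Lemma geodesic_meets_clique_once (G : sgraph) (x y : G) (p : seq G)
    (B e f : {set G}) :
  path_from_to x y p -> size p = dist x y -> clique B ->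
  e \in path_edges x p -> f \in path_edges x p ->
  e \subset B -> f \subset B -> e = f.
Proof.
case/and3P=> pP /eqP yE pU pd Bc /(nthP set0)[i + <-] /(nthP set0)[j + <-].
rewrite size_pairmap => ip jp.
rewrite !(nth_pairmap x) // !subUset !sub1set.
wlog ltij : i j ip jp / i < j => [wl|].
  case: (ltngtP i j) => [ij|ij|-> //]; first exact: wl.
  by move=> eB fB; symmetry; apply: wl ij fB eB.
case/andP=> aB _ /andP[_ dB]; exfalso.
set a := nth x (x :: p) i in aB; set d := nth x p j in dB.
(* [d] is the entry of index [j.+1] of [x :: p], hence the shift. *)
have aNd : a != d.
  rewrite -[d]/(nth x (x :: p) j.+1) /a nth_uniq //= ?ltnS //; lia.
have ltp : size (take i p ++ drop j p) < size p.
  by rewrite size_cat size_take size_drop ip; lia.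
suff : dist x y <= size (take i p ++ drop j p) by rewrite -pd; lia.
have aE : last x (take i p) = a.
  by rewrite /a -nth_last size_take ip; case: (i) => [|k]; rewrite ?take0 // nth_take.
have dropE : drop j p = d :: drop j.+1 p by rewrite (drop_nth x).
apply: dist_le_walk; last first.
  by rewrite -yE -[in RHS](cat_take_drop j p) !last_cat dropE.
have := pP; rewrite -{1}(cat_take_drop i p) !cat_path aE dropE /= => /andP[-> _].
have := pP; rewrite -{1}(cat_take_drop j p) cat_path dropE /=.
by case/andP=> _ /andP[_ ->]; rewrite andbT Bc.
Qed.

(** * Colourings by an arbitrary finite set *)

Definition singles_out_edge (G : sgraph) (T : eqType) (col : {set G} -> T)
    (x : G) (p : seq G) : Prop :=
  exists2 e, e \in path_edges x p &
    {in path_edges x p, forall f, col f = col e -> f = e}.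

(** Upper bounds on [scfc] come from this lemma: blocks themselves can serve as
    colours, on sets of vertices and not only on the subtype of edges, and
    deleting elements of [A] is what saves colours. *)
Lemma scfc_le_colors (G : sgraph) (Gc : connected G) (T : finType)
    (col : {set G} -> T) (A : {set T}) :
  (forall u v, adj u v -> col [set u; v] \in A) ->
  (forall x y, x != y -> exists2 p,
     path_from_to x y p /\ size p = dist x y & singles_out_edge col x p) ->
  scfc Gc <= #|A|.
Proof.
move=> colA colP; rewrite /scfc; case: ex_minnP => k _; apply.
have colA' (e : edge G) : col (val e) \in A.
  by case: e => e /= /imsetP[[u v]]; rewrite inE /= => uv ->; apply: colA.
pose c := [ffun e : edge G => enum_rank_in (colA' e) (col (val e))].
apply/existsP; exists c; apply/'forall_forallP => x y; apply/implyP => xNy.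
have [p [pP ps] [e ep eU]] := colP x y xNy.
have/eqP pt := ps; apply/existsP; exists (Tuple pt); rewrite pP /=.
have [[u v] uv eE] := path_edges_adj (andP pP).1 ep.
have eE' : e \in edge_set G by apply/imsetP; exists (u, v); rewrite ?inE.
pose e' : edge G := Sub e eE'.
apply/existsP; exists (c e'); apply/cards1P; exists e'; apply/setP => f.
rewrite !inE; apply/andP/eqP => [[fp /eqP cfe]|->]; last by rewrite ep.
apply/val_inj/eU => //; move: cfe; rewrite !ffunE => /(congr1 enum_val).
by rewrite !enum_rankK_in.
Qed.

Lemma singles_out_two (G : sgraph) (T : eqType) (col : {set G} -> T) (x z y : G) :
  col [set x; z] != col [set z; y] -> singles_out_edge col x [:: z; y].
Proof.
move=> cN; exists [set x; z]; rewrite ?inE ?eqxx // => f.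
by rewrite !inE => /pred2P[->|->] // cE; rewrite cE eqxx in cN.
Qed.

(** * Clique partitions of the edges *)

(** The last condition is that two blocks share at most one vertex; together
    with the second one it says that each edge lies in exactly one block. *)
Definition clique_partition (G : sgraph) (S : {set {set G}}) : Prop :=
  [/\ {in S, forall B, clique B},
      forall u v, adj u v -> exists2 B, B \in S & [set u; v] \subset B &
      {in S &, forall (B C : {set G}) (u v : G), u != v -> [set u; v] \subset B ->
         [set u; v] \subset C -> B = C}].

Definition block (G : sgraph) (S : {set {set G}}) (e : {set G}) : {set G} :=
  odflt set0 [pick B in S | e \subset B].

Lemma adj_neq (G : sgraph) (u v : G) : adj u v -> u != v.
Proof. by apply: contraTneq => ->; rewrite adj_irrefl. Qed.

Lemma blockP (G : sgraph) (S : {set {set G}}) (u v : G) :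
  clique_partition S -> adj u v ->
  block S [set u; v] \in S /\ [set u; v] \subset block S [set u; v].
Proof.
case=> _ cov _ uv; rewrite /block; case: pickP => [B /andP[] //|noB].
by have [B BS uvB] := cov u v uv; have := noB B; rewrite BS uvB.
Qed.

Lemma block_eq (G : sgraph) (S : {set {set G}}) (u v : G) (B : {set G}) :
  clique_partition S -> u != v -> B \in S -> u \in B -> v \in B ->
  adj u v /\ block S [set u; v] = B.
Proof.
move=> SP uNv BS uB vB; have [Scl _ lin] := SP.
have uv : adj u v by apply: (Scl B).
have [bS ub] := blockP SP uv; split=> //.
by apply: lin uNv ub _ => //; rewrite subUset !sub1set uB.
Qed.

Lemma geodesic_block_inj (G : sgraph) (S : {set {set G}}) (x y : G) (p : seq G) :
  clique_partition S -> path_from_to x y p -> size p = dist x y ->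
  {in path_edges x p &, injective (block S)}.
Proof.
move=> SP pP pd e f ep fp bE.
have [[u v] uv eE] := path_edges_adj (andP pP).1 ep.
have [[u' v'] uv' fE] := path_edges_adj (andP pP).1 fp.
have [bS eb] := blockP SP uv; have [_ fb] := blockP SP uv'.
rewrite /= -eE in bS eb; rewrite /= -fE -bE in fb.
by have [Scl _ _] := SP; apply: (geodesic_meets_clique_once pP pd (Scl _ bS)).
Qed.

(** Colouring each edge by its block gives distinct colours to the edges of any
    geodesic, so any edge of the geodesic will do. *)
Lemma scfc_le_clique_partition (G : sgraph) (Gc : connected G)
    (S : {set {set G}}) :
  clique_partition S -> scfc Gc <= #|S|.
Proof.
move=> SP; apply: (@scfc_le_colors _ _ _ (block S)) => [u v uv|x y xNy].
  by have [] := blockP SP uv.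
have [p pP pd] := geodesic_exists x y Gc; exists p => //.
have inj := geodesic_block_inj SP pP pd.
case: p pP pd inj => [|z p] pP pd inj.
  by case/and3P: pP xNy => _ /= ->.
have zp : [set x; z] \in path_edges x (z :: p) by rewrite inE eqxx.
by exists [set x; z] => // f fp /inj->.
Qed.

(** The two disjoint blocks may share a colour. Of the first two edges of a
    geodesic, one lies outside both blocks: the blocks of these edges are
    different, and both contain the common vertex of the edges. The colour of
    the edge outside is not repeated. *)
Lemma scfc_lt_disjoint_blocks (G : sgraph) (Gc : connected G)
    (S : {set {set G}}) (A B : {set G}) :
  clique_partition S -> A \in S -> B \in S -> A != B -> [disjoint A & B] ->
  scfc Gc < #|S|.
Proof.
move=> SP AS BS ANB AB0; rewrite (cardsD1 B) BS ltnS.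
pose col e := if block S e == B then A else block S e.
have colI e f : block S e != A -> block S e != B -> col f = col e ->
    block S f = block S e.
  rewrite /col => /negPf eA /negPf ->; case: ifP => // _ Ae.
  by rewrite -Ae eqxx in eA.
apply: (@scfc_le_colors _ _ _ col) => [u v uv|x y xNy].
  have [bS _] := blockP SP uv; rewrite /col !inE.
  by case: ifP => [_|/negbT ->]; rewrite ?ANB.
have [p pP pd] := geodesic_exists x y Gc; exists p => //.
have inj := geodesic_block_inj SP pP pd.
have sing e : e \in path_edges x p -> block S e != A -> block S e != B ->
    singles_out_edge col x p.
  by move=> ep eA eB; exists e => // f fp fe; apply: inj => //; apply: colI.
case: p pP pd inj sing => [|z p] pP pd inj sing.
  by case/and3P: pP xNy => _ /= ->.
have zp : [set x; z] \in path_edges x (z :: p) by rewrite inE eqxx.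
case: p pP pd inj sing zp => [|w p] pP pd inj sing zp.
  by exists [set x; z] => // f; rewrite inE => /eqP.
have wp : [set z; w] \in path_edges x [:: z, w & p] by rewrite !inE eqxx orbT.
have [/and3P[xz zw _] _ xU] := and3P pP.
have [xzS xzb] := blockP SP xz; have [zwS zwb] := blockP SP zw.
have zb1 : z \in block S [set x; z] by apply: (subsetP xzb); rewrite !inE eqxx orbT.
have zb2 : z \in block S [set z; w] by apply: (subsetP zwb); rewrite !inE eqxx.
have bN : block S [set x; z] != block S [set z; w].
  apply/eqP => /(inj _ _ zp wp) /setP/(_ x); rewrite !inE eqxx /=.
  by move: xU; rewrite /= !inE => /andP[/norP[/negPf-> /norP[/negPf-> _]]].
have zAB : z \in A -> z \in B -> False by move=> /(disjointFr AB0)->.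
have [xzA|xzA] := eqVneq (block S [set x; z]) A.
  apply: (sing _ wp); first by rewrite -xzA eq_sym.
  by apply/eqP => zwB; apply: zAB; rewrite -?xzA -?zwB.
have [xzB|xzB] := eqVneq (block S [set x; z]) B; last exact: sing zp _ _.
apply: (sing _ wp); last by rewrite -xzB eq_sym.
by apply/eqP => zwA; apply: zAB; rewrite -?xzB -?zwA.
Qed.

(** * Intersecting blocks without a common vertex *)

Definition intersecting (T : finType) (S : {set {set T}}) : Prop :=
  {in S &, forall A B : {set T}, A != B -> ~~ [disjoint A & B]}.

(** Three cliques form a ring, with [a], [b], [c] the corners where [C] meets
    [A], [A] meets [B], and [B] meets [C]. Each clique uses [al] on the edges at
    its own corner, taken in this cyclic order, and [be] on the others. To go
    from [u] in [A] to a non-adjacent [w] in [B], pass through [b]: the edge to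
    [b] has colour [be] and the edge from [b] has colour [al]. This fails only
    if [u] is [a], but then [u] lies in [C], and the path through [c] has the
    colours [al] and [be]. *)
Lemma two_colored_corner (G : sgraph) (T : eqType) (col : {set G} -> T)
    (al be : T) (A B C : {set G}) (a b c u w : G) :
  clique A -> clique B -> clique C -> al != be ->
  a \in C -> a \in A -> b \in A -> b \in B -> c \in B -> c \in C ->
  a != b -> b != c -> c != a ->
  {in A &, forall x y : G, x != y ->
     col [set x; y] = if a \in [set x; y] then al else be} ->
  {in B &, forall x y : G, x != y ->
     col [set x; y] = if b \in [set x; y] then al else be} ->
  {in C &, forall x y : G, x != y ->
     col [set x; y] = if c \in [set x; y] then al else be} ->
  u \in A -> w \in B -> u != w -> ~~ adj u w ->
  exists z, [/\ adj u z, adj z w & col [set u; z] != col [set z; w]].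
Proof.
move=> Acl Bcl Ccl alNbe aC aA bA bB cB cC aNb bNc cNa colA colB colC uA wB uNw uwN.
have uNb : u != b by apply: contraNneq uwN => uE; apply: Bcl; rewrite // uE.
have bNw : b != w by apply: contraNneq uwN => wE; apply: Acl; rewrite // -wE.
have [uE|uNa] := eqVneq u a; last first.
  exists b; split; [exact: Acl | exact: Bcl |].
  rewrite colA // colB // !inE eqxx /= (eq_sym a u) (negPf uNa) (negPf aNb) /=.
  by rewrite eq_sym.
have cNw : c != w.
  by apply: contraNneq uwN => wE; apply: Ccl; rewrite // ?uE // -wE.
have aNc : a != c by rewrite eq_sym.
exists c; rewrite uE; split; [exact: Ccl | exact: Bcl |].
rewrite colC // colB // !inE eqxx orbT.
by rewrite (negPf bNc) (negPf bNw).
Qed.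

Lemma vertex_in_block (G : sgraph) (S : {set {set G}}) (x y : G) :
  connected G -> clique_partition S -> x != y -> exists2 B, B \in S & x \in B.
Proof.
move=> Gc [_ cov _] xNy; have [[|z p] + _] := geodesic_exists x y Gc.
  by case/and3P=> _ /= xy; rewrite (negPf xNy) in xy.
case/and3P=> /andP[xz _] _ _; have [B BS] := cov x z xz.
by rewrite subUset !sub1set => /andP[xB _]; exists B.
Qed.

(** When the blocks pairwise intersect, non-adjacent vertices are at distance two
    and have a common neighbour in the intersection of any blocks that contain
    them. So only the ring of [A], [B], [C] needs care when its blocks are
    given two colours instead of three, and it is dealt with corner by corner.
    An example is the triangle with a further triangle on each of its sides: two
    of the outer triangles cannot both be coloured with one and the same colour. *)
Lemma scfc_lt_three_blocks (G : sgraph) (Gc : connected G) (S : {set {set G}})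
    (A B C : {set G}) (a b c : G) :
  clique_partition S -> intersecting S ->
  A \in S -> B \in S -> C \in S -> A != B -> B != C -> C != A ->
  a \in C -> a \in A -> b \in A -> b \in B -> c \in B -> c \in C ->
  a != b -> b != c -> c != a ->
  scfc Gc < #|S|.
Proof.
move=> SP SI AS BS CS ANB BNC CNA aC aA bA bB cB cC aNb bNc cNa.
have [Scl _ _] := SP; rewrite (cardsD1 C) CS ltnS.
(* The blocks [A] and [B] serve as the two colours, and [C] is saved. *)
pose col e := let X := block S e in
  if X == A then if a \in e then A else B else
  if X == B then if b \in e then A else B else
  if X == C then if c \in e then A else B else X.
have colA : {in A &, forall x y : G, x != y ->
    col [set x; y] = if a \in [set x; y] then A else B}.
  by move=> x y xA yA xNy; rewrite /col (block_eq SP xNy AS xA yA).2 eqxx.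
have colB : {in B &, forall x y : G, x != y ->
    col [set x; y] = if b \in [set x; y] then A else B}.
  move=> x y xB yB xNy; rewrite /col (block_eq SP xNy BS xB yB).2 eqxx.
  by rewrite eq_sym (negPf ANB).
have colC : {in C &, forall x y : G, x != y ->
    col [set x; y] = if c \in [set x; y] then A else B}.
  move=> x y xC yC xNy; rewrite /col (block_eq SP xNy CS xC yC).2 eqxx.
  by rewrite (eq_sym C B) (negPf CNA) (negPf BNC).
have colX X : X \in S -> X \notin [:: A; B; C] ->
    {in X &, forall x y : G, x != y -> col [set x; y] = X}.
  move=> XS; rewrite !inE !negb_or => /and3P[XA XB XC] x y xX yX xNy.
  rewrite /col (block_eq SP xNy XS xX yX).2.
  by rewrite (negPf XA) (negPf XB) (negPf XC).
have colN X Y : X \in S -> Y \in S -> X \notin [:: A; B; C] -> Y != X ->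
    {in Y &, forall x y : G, x != y -> col [set x; y] != X}.
  move=> XS YS XN YNX x y xY yY xNy; rewrite /col (block_eq SP xNy YS xY yY).2 /=.
  move: XN; rewrite !inE !negb_or ![X == _]eq_sym => /and3P[XA XB XC].
  by do 6?case: ifP.
have clA := Scl _ AS; have clB := Scl _ BS; have clC := Scl _ CS.
(* If [X] or [Y] is outside the ring, then any vertex of both blocks works. *)
have corner x y X Y : X \in S -> Y \in S -> x \in X -> y \in Y ->
    x != y -> ~~ adj x y ->
    exists z, [/\ adj x z, adj z y & col [set x; z] != col [set z; y]].
  move=> XS YS xX yY xNy xyN.
  have sym : (exists z, [/\ adj y z, adj z x & col [set y; z] != col [set z; x]]) ->
      exists z, [/\ adj x z, adj z y & col [set x; z] != col [set z; y]].
    case=> z [yz zx cN]; exists z.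
    by rewrite adj_sym zx adj_sym yz eq_sym [[set z; y]]setUC [[set x; z]]setUC.
  have yNx : y != x by rewrite eq_sym.
  have yxN : ~~ adj y x by rewrite adj_sym.
  have XNY : X != Y.
    by apply: contraNneq xyN => XY; apply: (Scl X) => //; rewrite XY.
  have /pred0Pn[z /andP[/= zX zY]] := SI _ _ XS YS XNY.
  have xNz : x != z.
    by apply: contraNneq xyN => xE; apply: (Scl Y) => //; rewrite xE.
  have zNy : z != y.
    by apply: contraNneq xyN => yE; apply: (Scl X) => //; rewrite -yE.
  have xz : adj x z by apply: (Scl X).
  have zy : adj z y by apply: (Scl Y).
  have [XN|] := boolP (X \notin [:: A; B; C]); last rewrite negbK => XABC.
    by exists z; rewrite (colX X XS XN x z) // eq_sym (colN X Y) // eq_sym.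
  have [YN|] := boolP (Y \notin [:: A; B; C]); last rewrite negbK => YABC.
    by exists z; rewrite (colX Y YS YN z y) // (colN Y X).
  have AB u w := @two_colored_corner G _ col A B A B C a b c u w clA clB clC ANB
    aC aA bA bB cB cC aNb bNc cNa colA colB colC.
  have BC u w := @two_colored_corner G _ col A B B C A b c a u w clB clC clA ANB
    bA bB cB cC aC aA bNc cNa aNb colB colC colA.
  have CA u w := @two_colored_corner G _ col A B C A B c a b u w clC clA clB ANB
    cB cC aC aA bA bB cNa aNb bNc colC colA colB.
  move: XABC YABC XNY xX yY; rewrite !inE.
  by move=> /or3P[]/eqP-> /or3P[]/eqP->; rewrite ?eqxx // => _ xX yY;
    first [exact: AB | exact: BC | exact: CA
          | apply: sym; first [exact: AB | exact: BC | exact: CA]].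
apply: (@scfc_le_colors _ _ _ col) => [u v uv|x y xNy].
  have [bS _] := blockP SP uv; rewrite /col !inE.
  have AC : (A != C) && (A \in S) by rewrite eq_sym CNA.
  have BC : (B != C) && (B \in S) by rewrite BNC.
  by do 5?[case: ifP => //]; rewrite bS => ->.
have yNx : y != x by rewrite eq_sym.
have [xy|xyN] := boolP (adj x y).
  have [p pP pd] := geodesic_exists x y Gc; exists p => //.
  have : size p <= 1 by rewrite pd (@dist_le_walk _ _ _ [:: y]) //= xy.
  case: p pP {pd} => [/and3P[_ /=]|z [|//] _ _]; first by rewrite (negPf xNy).
  by exists [set x; z]; rewrite ?inE // => f; rewrite inE => /eqP.
have [X XS xX] := vertex_in_block Gc SP xNy; have [Y YS yY] := vertex_in_block Gc SP yNx.
have [z [xz zy cN]] := corner x y X Y XS YS xX yY xNy xyN.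
exists [:: z; y]; last exact: singles_out_two.
rewrite (dist_common_neighbour Gc xNy xyN xz zy) /path_from_to /= xz zy eqxx !inE.
by rewrite (negPf xNy) (negPf (adj_neq xz)) (negPf (adj_neq zy)).
Qed.

(** Either two blocks are disjoint, or a ring of three blocks exists: take [A],
    then [B] avoiding a vertex of [A], then [C] avoiding the vertex where [A]
    and [B] meet. *)
Lemma scfc_lt_no_common_vertex (G : sgraph) (Gc : connected G)
    (S : {set {set G}}) :
  clique_partition S -> set0 \notin S ->
  (forall v, exists2 B, B \in S & v \notin B) ->
  scfc Gc < #|S|.
Proof.
move=> SP S0 noC; have [_ _ lin] := SP.
have [[[A B] /= /and4P[AS BS ANB AB0]]|noD] :=
  pickP [pred X : {set G} * {set G} | [&& X.1 \in S, X.2 \in S, X.1 != X.2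
                                        & [disjoint X.1 & X.2]]].
  exact: scfc_lt_disjoint_blocks AB0.
have SI : intersecting S.
  by move=> A B AS BS ANB; have := noD (A, B); rewrite /= AS BS ANB /= => ->.
have [v0 _] : exists v0, v0 \in G by apply/card_gt0P; case/andP: Gc.
have [A AS _] := noC v0.
have [a0 a0A] : exists a0, a0 \in A by apply/set0Pn; apply: contraNneq S0 => <-.
have neq (X Y : {set G}) v : v \in X -> v \notin Y -> X != Y.
  by move=> vX; apply: contraNneq => <-.
have [B BS a0B] := noC a0; have ANB := neq _ _ _ a0A a0B.
have /pred0Pn[b /andP[/= bA bB]] := SI _ _ AS BS ANB.
have [C CS bC] := noC b.
have BNC := neq _ _ _ bB bC; have CNA : C != A by rewrite eq_sym (neq _ _ b).
have /pred0Pn[a /andP[/= aC aA]] := SI _ _ CS AS CNA.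
have /pred0Pn[c /andP[/= cB cC]] := SI _ _ BS CS BNC.
have aNb : a != b by apply: contraNneq bC => <-.
have bNc : b != c by apply: contraNneq bC => ->.
have cNa : c != a.
  apply: contraNneq ANB => ca.
  by apply/eqP/(lin _ _ AS BS b c); rewrite // subUset !sub1set ?bA ?bB // ca.
exact: (@scfc_lt_three_blocks _ _ _ A B C a b c).
Qed.

(** * The partition given by edge-disjoint triangles *)

Definition edge_disjoint_triangles (G : sgraph) (F : {set {set G}}) : Prop :=
  {in F, forall T, triangle T} /\
  {in F &, forall T1 T2 : {set G}, T1 != T2 ->
    [disjoint edges_within T1 & edges_within T2]}.

Definition uncovered_edges (G : sgraph) (F : {set {set G}}) : {set {set G}} :=
  [set e in edge_set G | ~~ [exists T in F, e \subset T]].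

Definition triangle_partition (G : sgraph) (F : {set {set G}}) : {set {set G}} :=
  F :|: uncovered_edges F.

Lemma in_edge_set (G : sgraph) (u v : G) : ([set u; v] \in edge_set G) = adj u v.
Proof.
apply/imsetP/idP => [[[a b]]|uv]; last by exists (u, v); rewrite ?inE.
rewrite inE /= => ab uvE; have aNb := adj_neq ab.
have : a \in [set u; v] by rewrite uvE !inE eqxx.
have : b \in [set u; v] by rewrite uvE !inE eqxx orbT.
rewrite !inE => /pred2P[] bE /pred2P[] aE; move: ab aNb;
  by rewrite aE bE ?eqxx // adj_sym.
Qed.

Lemma edge_setP (G : sgraph) (e : {set G}) :
  reflect (exists2 uv : G * G, adj uv.1 uv.2 & e = [set uv.1; uv.2])
          (e \in edge_set G).
Proof. by apply: (iffP imsetP) => -[uv]; rewrite ?inE => uvP ->; exists uv; rewrite ?inE. Qed.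

Lemma card_edge (G : sgraph) (e : {set G}) : e \in edge_set G -> #|e| = 2.
Proof. by case/edge_setP=> -[u v] /= /adj_neq uv ->; rewrite cards2 uv. Qed.

Lemma triangle_clique (G : sgraph) (T : {set G}) : triangle T -> clique T.
Proof.
case/andP=> _ /forall_inP TP u v uT vT uv.
by move/(_ u uT)/forall_inP/(_ v vT): TP; rewrite uv.
Qed.

Lemma card_edges_within (G : sgraph) (T : {set G}) :
  triangle T -> #|edges_within T| = 3.
Proof.
move=> TT; rewrite -[RHS]/'C(3, 2) -(eqP (andP TT).1) -cards_draws.
apply: eq_card => e; rewrite !inE andbC; case eT: (e \subset T) => //=.
apply/edge_setP/cards2P => [[[u v] /= /adj_neq uv ->]|[u [v [uv eE]]]].
  by exists u, v.
move: eT; rewrite eE subUset !sub1set => /andP[uT vT].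
by exists (u, v) => //=; apply: (triangle_clique TT).
Qed.

Lemma triangle_partitionP (G : sgraph) (F : {set {set G}}) :
  edge_disjoint_triangles F -> clique_partition (triangle_partition F).
Proof.
case=> FT FD; split=> [B|u v uv|B C BS CS u v uNv uvB uvC].
- rewrite !inE => /orP[/FT/triangle_clique//|/andP[/edge_setP[[u v] /= uv ->] _]].
  move=> a b; rewrite !inE => /pred2P[]-> /pred2P[]->; rewrite ?eqxx //.
  by rewrite adj_sym.
- case: (boolP [exists T in F, [set u; v] \subset T]) => [/exists_inP[T TF uvT]|N].
    by exists T; rewrite // inE TF.
  by exists [set u; v]; rewrite // !inE in_edge_set uv N orbT.
have edgeE e : e \in edge_set G -> [set u; v] \subset e -> [set u; v] = e.
  by move=> eE uve; apply/eqP; rewrite eqEcard uve (card_edge eE) cards2 uNv.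
move: BS CS; rewrite !inE => /orP[BF|/andP[BE /exists_inP BN]].
  case/orP=> [CF|/andP[CE /exists_inP[]]]; last first.
    by exists B; rewrite // -(edgeE C).
  apply/eqP; apply: contraTT isT => /(FD _ _ BF CF)/pred0P/(_ [set u; v]).
  by rewrite /= !inE uvB uvC in_edge_set (triangle_clique (FT B BF)) //;
    apply: (subsetP uvB); rewrite !inE eqxx ?orbT.
case/orP=> [CF|/andP[CE _]]; last by rewrite -(edgeE B) // -(edgeE C).
by case: BN; exists C; rewrite // -(edgeE B).
Qed.

Lemma set0_triangle_partition (G : sgraph) (F : {set {set G}}) :
  edge_disjoint_triangles F -> set0 \notin triangle_partition F.
Proof.
case=> FT _; rewrite !inE negb_or; apply/andP; split.
  by apply/negP => /FT/andP[]; rewrite cards0.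
by apply/negP => /andP[/card_edge]; rewrite cards0.
Qed.

(** The edges covered by triangles are partitioned into the edge sets, of size
    three, of the triangles. *)
Lemma card_uncovered_edges (G : sgraph) (F : {set {set G}}) :
  edge_disjoint_triangles F ->
  #|edge_set G| = 3 * #|F| + #|uncovered_edges F|.
Proof.
case=> FT FD; rewrite -(cardsID [set e : {set G} | [exists T in F, e \subset T]] (edge_set G)).
congr (_ + _); last by apply: eq_card => e; rewrite !inE andbC.
have nonempty T : T \in F -> ~~ [disjoint edges_within T & edges_within T].
  by move/FT/card_edges_within => T3; rewrite -setI_eq0 setIid -cards_eq0 T3.
have injw : {in F &, injective (@edges_within G)}.
  move=> T1 T2 T1F T2F TE; apply/eqP; apply: contraTT (nonempty _ T1F) => T1N2.
  by rewrite negbK {2}TE; apply: FD.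
rewrite mulnC -(card_in_imset injw).
apply: card_uniform_partition => [_ /imsetP[T TF ->]|].
  exact/card_edges_within/FT.
apply/and3P; split.
- apply/eqP/setP => e; rewrite cover_imset !inE; apply/bigcupP/andP.
    case=> T TF; rewrite inE => /andP[eE eT]; split=> //.
    by apply/exists_inP; exists T.
  by case=> eE /exists_inP[T TF eT]; exists T; rewrite // inE eE.
- apply/trivIsetP => _ _ /imsetP[T1 T1F ->] /imsetP[T2 T2F ->] TN.
  by apply: FD => //; apply: contraNneq TN => ->.
by apply/imsetP => -[T /FT/card_edges_within T3 T0]; rewrite -T0 cards0 in T3.
Qed.

Lemma card_triangle_partition (G : sgraph) (F : {set {set G}}) :
  edge_disjoint_triangles F ->
  #|triangle_partition F| = #|edge_set G| - 2 * #|F|.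
Proof.
move=> FP; rewrite (card_uncovered_edges FP) cardsU.
suff -> : F :&: uncovered_edges F = set0 by rewrite cards0; lia.
apply/setP => T; rewrite !inE; apply/and3P => -[TF _ /exists_inP[]].
by exists T.
Qed.

(** * Lower bound for the star with triangles *)

(** The only geodesic from [h i] to [h j] is through [z], so the edges from [z] to
    [h i] and to [h j] must have different colours. *)
Lemma scf_colors_ge (G : sgraph) (k : nat) (J : finType) (h : J -> G) (z : G) :
  connected G ->
  (forall i, adj z (h i)) ->
  (forall i j, i != j -> [/\ h i != h j, ~~ adj (h i) (h j) &
     forall w, adj (h i) w -> adj w (h j) -> w = z]) ->
  scf_colorable G k -> #|J| <= k.
Proof.
move=> Gc zh hP /existsP[c /'forall_forallP cP].
have hE i : [set z; h i] \in edge_set G by rewrite in_edge_set.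
pose spoke i : edge G := Sub [set z; h i] (hE i).
have spokeE i : val (spoke i) = [set z; h i] by [].
move: spoke spokeE => spoke spokeE; pose g i := c (spoke i).
suff ginj : injective g by rewrite -[k]card_ord; apply: leq_card ginj.
move=> i j gE; apply/eqP; apply: contraTT isT => iNj.
have [hN hA hz] := hP i j iNj.
have hiz : adj (h i) z by rewrite adj_sym.
have /implyP/(_ hN)/existsP[[p /= /eqP]] := cP (h i) (h j).
rewrite (dist_common_neighbour Gc hN hA hiz (zh j)).
case: p => [|w [|y []]] //= _ /andP[/and3P[/= /and3P[iw wy _] /eqP yE _]].
rewrite {y}yE in wy *; rewrite {w iw wy}(hz w iw wy).
case/existsP=> a /cards1P[e eE].
have spoke_e l : l \in [:: i; j] -> g l = a -> spoke l = e.
  move=> lij gl; apply/set1P; rewrite -eE inE -[c _]/(g l) gl eqxx andbT spokeE.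
  by move: lij; rewrite !inE => /pred2P[]->; rewrite 1?setUC eqxx ?orbT.
have gia : g i = a.
  have : e \in [set e] by rewrite inE.
  rewrite -eE inE => /andP[+ /eqP <-]; rewrite !inE => /pred2P[] eV.
    by congr (c _); apply: val_inj; rewrite spokeE eV setUC.
  by rewrite gE; congr (c _); apply: val_inj; rewrite spokeE eV.
have : spoke i = spoke j.
  by rewrite !spoke_e -?gE ?inE ?eqxx ?orbT.
move/(congr1 val); rewrite !spokeE => /setP/(_ (h i)); rewrite !inE eqxx orbT.
by rewrite (negPf hN) (eq_sym _ z) (negPf (adj_neq (zh i))).
Qed.

(** One leaf of each triangle, and every pendant vertex: these are [m - 2 * t]
    leaves to which the previous lemma applies. *)
Lemma scfc_ge_star_tri (m t : nat) (G : sgraph) (Gc : connected G) :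
  3 * t <= m -> sg_iso G (star_tri m t) -> m - 2 * t <= scfc Gc.
Proof.
move=> tm [f [g fK gK] fA].
have gA a b : adj (g a) (g b) = @star_tri_adj m t a b by rewrite -fA !gK.
rewrite /scfc; case: ex_minnP => k kP _.
(* Leaf [i.*2] is in triangle [i], and the pendant leaves start at [t.*2]. *)
have lt (i : 'I_(m - 2 * t)) : (if i < t then i.*2 else i + t) < m - t.
  by have := ltn_ord i; case: (ltnP i t); lia.
pose h i := g (Some (Ordinal (lt i))).
rewrite -[m - _]card_ord; apply: (@scf_colors_ge _ _ _ h (g None) Gc) kP => [i|i j iNj].
  by rewrite gA.
have iNj' : (i : nat) != j by [].
rewrite (inj_eq (can_inj gK)) !gA; split.
- by apply/eqP => -[]; case: (ltnP i t); case: (ltnP j t); lia.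
- by rewrite /star_tri_adj /= -val_eqE /=; case: (ltnP i t); case: (ltnP j t); lia.
move=> w; rewrite -(fK w) !gA; case: (f w) => [l|//].
by rewrite /star_tri_adj /= -!val_eqE /=; case: (ltnP i t); case: (ltnP j t); lia.
Qed.

(** * Recognising the star with triangles *)

(** If all blocks contain [v], they are otherwise disjoint, so the graph is a
    bunch of triangles and pendant edges at [v]. The vertices other than [v] are
    numbered triangle by triangle, two for each, and then come the pendant ones.
    The bounds on these numbers make the numbering well defined; since the edges
    are the spokes and the sides opposite to [v], there are enough vertices for
    it to be onto. *)
Lemma star_tri_iso (G : sgraph) (Gc : connected G) (F : {set {set G}}) (v : G) :
  edge_disjoint_triangles F ->
  (forall B, B \in triangle_partition F -> v \in B) ->
  sg_iso G (star_tri #|edge_set G| #|F|).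
Proof.
move=> FP vB; have SP := triangle_partitionP FP; have [FT FD] := FP.
have [Scl cov lin] := SP; have mE := card_uncovered_edges FP.
set m := #|edge_set G| in mE *; set t := #|F| in mE *.
have FS T : T \in F -> T \in triangle_partition F by rewrite inE => ->.
have vT T : T \in F -> v \in T by move/FS/vB.
have vadj u : u != v -> adj v u.
  move=> uNv; have [B BS uB] := vertex_in_block Gc SP uNv.
  by apply: (Scl B); rewrite ?vB // eq_sym.
have Funiq T T' u : u != v -> T \in F -> T' \in F -> u \in T -> u \in T' -> T = T'.
  move=> uNv TF T'F uT uT'; apply: (lin _ _ (FS _ TF) (FS _ T'F) u v) => //.
    by rewrite subUset !sub1set uT vT.
  by rewrite subUset !sub1set uT' vT.
have adjF u w : u != v -> w != v -> adj u w ->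
    exists T, [/\ T \in F, u \in T & w \in T].
  move=> uNv wNv uw; have [B BS] := cov u w uw; rewrite subUset !sub1set.
  case/andP=> uB wB; exists B; split=> //.
  move: BS (vB B BS); rewrite !inE => /orP[//|/andP[/card_edge B2 _]] vB'.
  have : [set v; u; w] \subset B by rewrite !subUset !sub1set vB' uB.
  move/subset_leq_card; rewrite B2 -setUA cardsU1 cards2 !inE.
  by rewrite (negPf (adj_neq uw)) ![v == _]eq_sym (negPf uNv) (negPf wNv).
have cardTv T : T \in F -> #|T :\ v| = 2.
  move=> TF; have /andP[/eqP] := FT _ TF.
  by rewrite (cardsD1 v) vT // add1n => -[].
pose L := [set u | (u != v) && ~~ [exists T in F, u \in T]].
(* [L] is the set of pendant vertices. *)
pose idx u := if [pick T in F | u \in T] is Some T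
  then (index T (enum F)).*2 + index u (enum (T :\ v))
  else t.*2 + index u (enum L).
have idxP u : u != v ->
    (exists T, [/\ T \in F, u \in T, idx u = (index T (enum F)).*2 + index u (enum (T :\ v)),
       index T (enum F) < t & index u (enum (T :\ v)) < 2]) \/
    [/\ u \in L, idx u = t.*2 + index u (enum L) & index u (enum L) < #|L|].
  move=> uNv; rewrite /idx; case: pickP => [T /andP[TF uT]|noT]; [left|right].
    exists T; split=> //; first by rewrite /t cardE index_mem mem_enum.
    by rewrite -(cardTv T TF) cardE index_mem mem_enum !inE uNv.
  have uL : u \in L.
    rewrite inE uNv; apply/negP => /exists_inP[T TF uT].
    by have := noT T; rewrite TF uT.
  by split=> //; rewrite cardE index_mem mem_enum.
have cardL : #|L| <= #|uncovered_edges F|.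
  have inj : {in L &, injective (fun u => [set v; u])}.
    move=> u w; rewrite !inE => /andP[uNv _] _ /setP/(_ u).
    by rewrite !inE eqxx orbT (negPf uNv) => /esym/eqP.
  rewrite -(card_in_imset inj); apply/subset_leq_card/subsetP => _ /imsetP[u + ->].
  rewrite !inE in_edge_set => /andP[uNv uN]; rewrite vadj //=.
  apply: contraNN uN => /exists_inP[T TF vuT]; apply/exists_inP; exists T => //.
  by apply: (subsetP vuT); rewrite !inE eqxx orbT.
have idx_lt u : u != v -> idx u < m - t.
  by case/idxP => [[T [_ _ -> ? ?]]|[_ -> ?]]; lia.
have enum_inj (T : finType) (A : {set T}) x y : x \in A -> y \in A -> 
    index x (enum A) = index y (enum A) -> x = y.
  by move=> xA yA; apply: index_inj; rewrite ?mem_enum.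
have idx_half u T : u != v -> T \in F -> u \in T -> (idx u)./2 = index T (enum F).
  move=> uNv TF uT; case: (idxP u uNv) => [[T' [T'F uT' -> _ ?]]|[+ _ _]].
    by rewrite (Funiq T T' u) //; lia.
  by rewrite inE uNv => /exists_inP[]; exists T.
have idx_inj u w : u != v -> w != v -> idx u = idx w -> u = w.
  move=> uNv wNv.
  case: (idxP u uNv) => [[T [TF uT -> ? ?]]|[uL -> ?]];
  case: (idxP w wNv) => [[T' [T'F wT' -> ? ?]]|[wL -> ?]] E; try lia.
    have TE : T = T' by apply: enum_inj TF T'F _; lia.
    subst T'.
    by apply: (enum_inj _ (T :\ v)); rewrite ?inE ?uNv ?wNv //; lia.
  by apply: enum_inj uL wL _; lia.
pose f u : option 'I_(m - t) := if u == v then None else insub (idx u).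
have fE u (uNv : u != v) : f u = Some (Ordinal (idx_lt u uNv)).
  by rewrite /f (negPf uNv) (insubT (fun i => i < m - t) (idx_lt u uNv)).
have fv : f v = None by rewrite /f eqxx.
have finj : injective f.
  move=> u w; have [->|uNv] := eqVneq u v; have [->|wNv] := eqVneq w v => //.
  - by rewrite fv (fE _ wNv).
  - by rewrite fv (fE _ uNv).
  by rewrite !fE => -[/idx_inj]; apply.
exists f.
  apply: inj_card_bij finj _; rewrite card_option card_ord.
  have sub : edge_set G \subset [set [set v; u] | u in [set~ v]] :|: [set T :\ v | T in F].
    apply/subsetP => _ /edge_setP[[u w] /= uw ->]; rewrite inE.
    have [uE|uNv] := eqVneq u v.
      by apply/orP; left; apply/imsetP; exists w; rewrite ?uE // !inE -uE eq_sym adj_neq.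
    have [wE|wNv] := eqVneq w v.
      by apply/orP; left; apply/imsetP; exists u; rewrite ?wE 1?setUC // !inE.
    have [T [TF uT wT]] := adjF u w uNv wNv uw.
    apply/orP; right; apply/imsetP; exists T => //; apply/eqP.
    by rewrite eqEcard subUset !sub1set !inE uNv wNv uT wT cardTv // cards2 adj_neq.
  have spokes : #|[set [set v; u] | u in [set~ v]]| <= #|G|.-1.
    by rewrite -(cardsC1 v) leq_imset_card.
  have opposite : #|[set T :\ v | T in F]| <= t by apply: leq_imset_card.
  have G_gt0 : 0 < #|G| by case/andP: Gc.
  rewrite -(prednK G_gt0) ltnS leq_subLR addnC.
  apply: leq_trans (subset_leq_card sub) _; rewrite cardsU.
  by apply: leq_trans (leq_subr _ _) _; apply: leq_add.
move=> u w; have [->|uNv] := eqVneq u v; have [->|wNv] := eqVneq w v.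
- by rewrite fv !adj_irrefl.
- by rewrite fv (fE _ wNv) /= vadj.
- by rewrite fv (fE _ uNv) /= adj_sym vadj.
rewrite !fE /= -val_eqE /=.
have [<-|uNw] := eqVneq u w; first by rewrite eqxx adj_irrefl.
have -> : idx u != idx w by apply: contra_neq uNw; apply: idx_inj.
rewrite /=.
apply/andP/idP => [[/eqP hE]|/adjF[] // T [TF uT wT]]; last first.
  by rewrite !(idx_half _ T) // eqxx /t cardE index_mem mem_enum.
case: (idxP u uNv) => [[T [TF uT _ _ _]] _|[_ -> _]]; last lia.
case: (idxP w wNv) hE => [[T' [T'F wT' _ _ _]]|[_ -> _]]; last first.
  rewrite (idx_half _ T) //.
  have : index T (enum F) < t by rewrite /t cardE index_mem mem_enum.
  lia.
rewrite (idx_half _ T) // (idx_half _ T') // => TE.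
have {}TE : T = T' by apply: enum_inj TE.
by apply: (Scl T (FS _ TF)); rewrite // TE.
Qed.

Theorem theorem3p3 (m t : nat) (G : sgraph) (Gconn : connected G)
    (hm : 2 <= m) (hE : #|edge_set G| = m)
    (hT : has_edge_disjoint_triangles G t) :
  scfc Gconn <= m - 2 * t /\
  (scfc Gconn = m - 2 * t <-> sg_iso G (star_tri m t)).
Proof.
case: hT => F [<- FT FD]; have FP : edge_disjoint_triangles F by [].
have SP := triangle_partitionP FP.
have upper := scfc_le_clique_partition Gconn SP.
rewrite -{m}hE in hm *; rewrite -(card_triangle_partition FP).
split=> //; split=> [eq_scfc|iso].
  have [v vP] : exists v, forall B, B \in triangle_partition F -> v \in B.
    have [v /forall_inP vP|noC] :=
      pickP (fun v => [forall B in triangle_partition F, v \in B]).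
      by exists v.
    suff : scfc Gconn < #|triangle_partition F| by rewrite eq_scfc ltnn.
    apply: scfc_lt_no_common_vertex SP (set0_triangle_partition FP) _ => v.
    by have /negbT/forall_inPn[B BS vB] := noC v; exists B.
  exact: star_tri_iso vP.
apply/eqP; rewrite eqn_leq upper card_triangle_partition //.
by apply: scfc_ge_star_tri iso; rewrite (card_uncovered_edges FP) leq_addr.
Qed.
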